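(* For $n=1,2,3$, the C*-algebra $A(n)$ is commutative. Hence the natural surjection $A(n)\to A^{\mathrm{ab}}(n)$ sending $p_{i,j}$ to $p_{i,j}$ is an isomorphism for $n=1,2,3$.
   Context: For a positive integer $n$, $A(n)$ is the universal unital C*-algebra generated by projections $\{p_{i,j}\}_{i,j=1}^n$ satisfying $\sum_{i=1}^n p_{i,j}=1$ for every $j$ and $\sum_{j=1}^n p_{i,j}=1$ for every $i$. $A^{\mathrm{ab}}(n)$ is the universal unital C*-algebra generated by projections $\{p_{i,j}\}_{i,j=1}^n$ satisfying the same relations together with $p_{i,j}p_{k,l}=p_{k,l}p_{i,j}$ for all $i,j,k,l$. *)

(* Defs.v *)
(* MathComp and MathComp-Analysis. *)
From HB Require Import structures.
From mathcomp Require Import all_boot all_order all_algebra.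
From mathcomp Require Import complex.
From mathcomp Require Import all_classical all_reals all_analysis.

Set Implicit Arguments.
Unset Strict Implicit.
Unset Printing Implicit Defensive.

Import Order.TTheory GRing.Theory Num.Theory.
Import numFieldNormedType.Exports.

Local Open Scope classical_set_scope.
Local Open Scope ring_scope.

(* A unital C*-algebra is a complete normed space over [R[i]] with a unital
   associative product and an involution.  The norm of a normed module over
   [R[i]] takes its values in [R[i]] (in its nonnegative reals).  The zero
   algebra is allowed.  The ring operations are part of this mixin, and turned
   into a ring structure below, because Hierarchy Builder does not admit a new
   join of the ring and normed-module hierarchies below [numDomainType]. *)
HB.mixin Record isCStarAlgebra (R : realType) A
    of CompleteNormedModule R[i] A := {
  cstar_one : A;
  cstar_mul : A -> A -> A;
  star : A -> A;
  cstar_mulA : associative cstar_mul;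
  cstar_mul1l : left_id cstar_one cstar_mul;
  cstar_mul1r : right_id cstar_one cstar_mul;
  cstar_mulDl : left_distributive cstar_mul +%R;
  cstar_mulDr : right_distributive cstar_mul +%R;
  cstar_mulZl : forall (a : R[i]) (x y : A),
    cstar_mul (a *: x) y = a *: cstar_mul x y;
  cstar_mulZr : forall (a : R[i]) (x y : A),
    cstar_mul x (a *: y) = a *: cstar_mul x y;
  cstar_normM : forall x y : A, `|cstar_mul x y| <= `|x| * `|y|;
  starK : involutive star;
  starD : {morph star : x y / x + y};
  starZ : forall (a : R[i]) (x : A), star (a *: x) = conjc a *: star x;
  starM : forall x y : A, star (cstar_mul x y) = cstar_mul (star y) (star x);
  cstar_norm_star : forall x : A, `|cstar_mul (star x) x| = `|x| ^+ 2
}.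

#[short(type="cstarAlgType")]
HB.structure Definition CStarAlgebra (R : realType) :=
  { A of isCStarAlgebra R A & CompleteNormedModule R[i] A }.

HB.instance Definition _ (R : realType) (A : cstarAlgType R) :=
  GRing.Zmodule_isPzRing.Build (CStarAlgebra.sort A)
    (@cstar_mulA R A) (@cstar_mul1l R A) (@cstar_mul1r R A)
    (@cstar_mulDl R A) (@cstar_mulDr R A).

Section CStarAlgebras.
Variable R : realType.

(* Unital *-homomorphisms and unital *-subalgebras. *)
Definition star_hom (A B : cstarAlgType R) (f : A -> B) : Prop :=
  [/\ linear f, GRing.monoid_morphism f & {morph f : x / star x}].

(* For C*-algebras a bijective *-homomorphism has a *-homomorphism as inverse
   and is isometric. *)
Definition star_iso (A B : cstarAlgType R) (f : A -> B) : Prop :=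
  star_hom f /\ bijective f.

Definition star_subalgebra (A : cstarAlgType R) (S : set A) : Prop :=
  [/\ S 1,
      forall (a : R[i]) x y, S x -> S y -> S (a *: x + y),
      forall x y, S x -> S y -> S (x * y) &
      forall x, S x -> S (star x)].

Definition projection (A : cstarAlgType R) (x : A) : Prop :=
  star x = x /\ x * x = x.

Section Families.
Variable n : nat.

Definition generated_by (A : cstarAlgType R) (p : 'I_n -> 'I_n -> A) : Prop :=
  forall S : set A, star_subalgebra S -> closed S ->
    (forall i j, S (p i j)) -> S = setT.

Definition magic_unitary (A : cstarAlgType R) (p : 'I_n -> 'I_n -> A) : Prop :=
  [/\ forall i j, projection (p i j),
      forall j, \sum_(i < n) p i j = 1 &
      forall i, \sum_(j < n) p i j = 1].

Definition commuting_magic_unitary (A : cstarAlgType R)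
    (p : 'I_n -> 'I_n -> A) : Prop :=
  magic_unitary p /\ forall i j k l, p i j * p k l = p k l * p i j.

Definition maps_generators (A B : cstarAlgType R) (p : 'I_n -> 'I_n -> A)
    (q : 'I_n -> 'I_n -> B) (f : A -> B) : Prop :=
  star_hom f /\ forall i j, f (p i j) = q i j.

(* [A], with the family [p], is the universal unital C*-algebra generated by a
   family indexed by ['I_n * 'I_n] subject to the relations [rel]. *)
Definition universal_cstar
    (rel : forall B : cstarAlgType R, ('I_n -> 'I_n -> B) -> Prop)
    (A : cstarAlgType R) (p : 'I_n -> 'I_n -> A) : Prop :=
  [/\ rel A p,
      generated_by p &
      forall (B : cstarAlgType R) (q : 'I_n -> 'I_n -> B),
        rel B q -> exists! f : A -> B, maps_generators p q f].

(* [(A, p)] is A(n), resp. A^ab(n), with its canonical generators. *)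
Definition is_A (A : cstarAlgType R) (p : 'I_n -> 'I_n -> A) : Prop :=
  universal_cstar magic_unitary p.

Definition is_Aab (A : cstarAlgType R) (p : 'I_n -> 'I_n -> A) : Prop :=
  universal_cstar commuting_magic_unitary p.

End Families.
End CStarAlgebras.

(* Main.v *)
Require Import Defs.
From HB Require Import structures.
From mathcomp Require Import all_boot all_order all_algebra.
From mathcomp Require Import complex.
From mathcomp Require Import all_classical all_reals all_analysis.
Import Order.TTheory GRing.Theory Num.Theory.
Import numFieldNormedType.Exports.
Local Open Scope ring_scope.

(** Everything comes down to the entries of a magic unitary [p] of size
    [n <= 3] commuting; the argument is purely algebraic.

    Two distinct entries [p_a], [p_b] of one row (or column) are orthogonal:
    their sum is [1] minus the remaining entries, of which there is at most one,
    so it is idempotent, and two idempotents with idempotent sum are orthogonal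
    when [2] is cancellable ([idempotents_add_orthogonal]).  By orthogonality,
    entries sharing a row or a column commute.  For [i != k] and [j != l], insert
    [1 = \sum_m p_(i,m)] on the right of [p_(i,j) p_(k,l)]: the term [m = l]
    vanishes by orthogonality in column [l], and if [m] is neither [j] nor [l],
    then since [n <= 3] the indices [j], [l], [m] exhaust the row, and
<<
      p_(i,j) p_(k,l) p_(i,m) = p_(i,j) (\sum_l' p_(k,l')) p_(i,m)
                              = p_(i,j) p_(i,m) = 0.
>>
    Only the term [m = j] is left, so [p_(i,j) p_(k,l)] equals
    [p_(i,j) p_(k,l) p_(i,j)], which is self-adjoint, and therefore the two
    projections commute ([magic_unitary_entries_commute]).

    Commutation spreads from the generators to the algebra because the commutant
    of a self-adjoint family is a closed unital *-subalgebra
    ([generated_by_commuting]).  Finally, the generators of A(n) also satisfy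
    the relations of A^ab(n), so the universal properties provide mutually
    inverse maps. *)

(** * Idempotents *)

(** From [(p + q)^2 = p + q] one gets [p q = - q p]; multiplying by [p] on
    either side, [p q = - p q p = q p], so [2 p q = 0]. *)
Lemma idempotents_add_orthogonal (A : pzRingType) (p q : A)
    (two_inj : forall x : A, x + x = 0 -> x = 0) :
  p * p = p -> q * q = q -> (p + q) * (p + q) = p + q -> p * q = 0.
Proof.
move=> pp qq; rewrite mulrDl !mulrDr pp qq => e.
have anti : p * q = - (q * p).
  apply/eqP; rewrite -addr_eq0; apply/eqP.
  by apply: (addrI p); apply: (addIr q); rewrite addr0 -e -!addrA.
have left_pqp : p * q * p = - (p * q).
  by rewrite -mulrA -{1}[q * p]opprK -anti mulrN mulrA pp.
have right_pqp : p * q * p = - (q * p) by rewrite anti mulNr -mulrA pp.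
apply: two_inj; rewrite {2}anti -right_pqp left_pqp; exact: subrr.
Qed.

(** With at most three indices, a complement of two of them has at most one
    element. *)
Lemma idempotent_partition_orthogonal (A : pzRingType) (n : nat)
    (e : 'I_n -> A) (two_inj : forall x : A, x + x = 0 -> x = 0) :
  (n <= 3)%N -> (forall i, e i * e i = e i) -> \sum_(i < n) e i = 1 ->
  forall i j, i != j -> e i * e j = 0.
Proof.
move=> n3 ee e1 i j ij.
apply: idempotents_add_orthogonal => //.
set r := \sum_(k < n | (k != i) && (k != j)) e k.
have rE : e i + e j = 1 - r.
  by rewrite -e1 (bigD1 i) //= (bigD1 j) 1?eq_sym //= addrA addrK.
have rr : r * r = r.
  rewrite /r; case: (pickP (fun k => (k != i) && (k != j))) => [k kij|none].
    rewrite (big_pred1 k) // => m; apply/idP/eqP => [mij|-> //].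
    (* [i], [j] and a further pair [k], [m] would be four indices. *)
    apply/eqP; apply: contraLR n3 => mk; rewrite -ltnNge.
    have: uniq [:: i; j; k; m].
      by case/andP: kij mij => ki kj /andP[mi mj];
        rewrite /= !inE !negb_or ij ![_ == k]eq_sym ki kj !(eq_sym _ m) mi mj mk.
    by move/card_uniqP => /= <-; rewrite -[X in (_ <= X)%N]card_ord max_card.
  by rewrite big_pred0 // mulr0.
by rewrite rE mulrBl mul1r mulrBr mulr1 rr subrr subr0.
Qed.

(** * Commutants in C*-algebras *)

Section CStarAlgebraLemmas.
Variables (R : realType) (A : cstarAlgType R).
Implicit Types x y a : A.

Lemma cstar_addrr_eq0 x : x + x = 0 -> x = 0.
Proof.
move=> /eqP; rewrite -mulr2n -scaler_nat scaler_eq0 pnatr_eq0 /=.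
by move/eqP.
Qed.

(** The axioms on [cstar_mul], restated for the ring product it induces. *)
Lemma star_mulr x y : star (x * y) = star y * star x.
Proof. exact: starM. Qed.

Lemma cstar_norm_mulr x y : `|x * y| <= `|x| * `|y|.
Proof. exact: cstar_normM. Qed.

Lemma cstar_scalerAl (c : R[i]) x y : (c *: x) * y = c *: (x * y).
Proof. exact: cstar_mulZl. Qed.

Lemma cstar_scalerAr (c : R[i]) x y : x * (c *: y) = c *: (x * y).
Proof. exact: cstar_mulZr. Qed.

Lemma star1 : star (1 : A) = 1.
Proof. by rewrite -[LHS]mulr1 -[X in _ * X]starK -star_mulr mulr1 starK. Qed.

(** The elements commuting with every element of [D]. *)
Definition commutant (D : set A) : set A :=
  [set x | forall a, D a -> x * a = a * x]%classic.

Lemma closed_commutant (D : set A) : closed (commutant D).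
Proof.
move=> x clx a Da; apply/eqP; rewrite -subr_eq0; apply/negPn/negP => c0.
set c := x * a - a * x in c0 *.
have M0 : 0 < `|a| + `|a| + 1 by rewrite ltr_wpDl // addr_ge0.
have e0 : 0 < `|c| / (`|a| + `|a| + 1) by rewrite divr_gt0 // normr_gt0.
(* A point [y] of the commutant so close to [x] that
   [|c| <= 2 |a| |x - y| < |c|]. *)
have [y [/= /(_ a Da) ya]] := clx _ (nbhsx_ballx x _ e0).
rewrite -ball_normE /= ltr_pdivlMr // => lt_c.
have cE : c = (x - y) * a - a * (x - y).
  by rewrite mulrBl mulrBr ya opprB addrA subrK.
suff: `|c| < `|c| by rewrite ltxx.
apply: le_lt_trans lt_c; rewrite {1}cE.
apply: (le_trans (ler_normB _ _)).
apply: (le_trans (lerD (cstar_norm_mulr _ _) (cstar_norm_mulr _ _))).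
by rewrite [`|a| * _]mulrC -mulrDr ler_wpM2l // lerDl.
Qed.

Lemma star_subalgebra_commutant (D : set A) :
  (forall a, D a -> D (star a)) -> star_subalgebra (commutant D).
Proof.
move=> Dstar; split=> [a _|c x y Sx Sy a Da|x y Sx Sy a Da|x Sx a Da].
- by rewrite mul1r mulr1.
- by rewrite mulrDl mulrDr cstar_scalerAl cstar_scalerAr Sx ?Sy.
- by rewrite -mulrA Sy // mulrA Sx // mulrA.
- by rewrite -[a]starK -!star_mulr Sx //; apply: Dstar.
Qed.

(** A C*-algebra generated by self-adjoint, pairwise commuting elements is
    commutative: the commutant of the generators is everything, so the
    generators lie in the commutant of the whole algebra, which is then
    everything too. *)
Lemma generated_by_commuting (n : nat) (p : 'I_n -> 'I_n -> A) :
  generated_by p -> (forall i j, star (p i j) = p i j) ->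
  (forall i j k l, p i j * p k l = p k l * p i j) ->
  forall x y, x * y = y * x.
Proof.
move=> gen sa pC.
have pT (D : set A) : (forall a, D a -> D (star a)) ->
    (forall i j, commutant D (p i j)) -> forall x, commutant D x.
  move=> Dstar Dp x; rewrite (gen (commutant D)) //.
    exact: star_subalgebra_commutant.
  exact: closed_commutant.
pose P : set A := [set a | exists i j, a = p i j]%classic.
have pcentral : forall x, commutant P x.
  apply: pT => [_ [i [j ->]]|i j _ [k [l ->]]]; last exact: pC.
  by exists i, j; rewrite sa.
move=> x y; apply: (pT setT) => // i j a _.
by apply/esym/pcentral; exists i, j.
Qed.

(** * Magic unitaries of size at most three *)

Lemma magic_unitary_entries_commute (n : nat) (p : 'I_n -> 'I_n -> A) :
  (n <= 3)%N -> magic_unitary p ->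
  forall i j k l, p i j * p k l = p k l * p i j.
Proof.
move=> n3 [pP colp rowp] i j k l.
have idem i' j' : p i' j' * p i' j' = p i' j' by have [] := pP i' j'.
have sa i' j' : star (p i' j') = p i' j' by have [] := pP i' j'.
have row0 i' j' l' : j' != l' -> p i' j' * p i' l' = 0.
  exact: (idempotent_partition_orthogonal _ _ (p i')
            cstar_addrr_eq0 n3 (idem i') (rowp i')).
have col0 i' k' j' : i' != k' -> p i' j' * p k' j' = 0.
  exact: (idempotent_partition_orthogonal _ _ (p ^~ j')
            cstar_addrr_eq0 n3 (idem ^~ j') (colp j')).
have [<-|ik] := eqVneq i k.
  have [<- //|jl] := eqVneq j l.
  by rewrite !row0 // eq_sym.
have [<-|jl] := eqVneq j l; first by rewrite !col0 // eq_sym.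
have zero_term m : m != j -> p i j * p k l * p i m = 0.
  move=> mj; have [->|ml] := eqVneq m l.
    by rewrite -mulrA col0 1?eq_sym // mulr0.
  rewrite -(row0 i j m) 1?eq_sym // -[in RHS](mulr1 (p i j)) -(rowp k).
  rewrite mulr_sumr mulr_suml (bigD1 l) //= big1 ?addr0 // => l' ll'.
  have [->|l'j] := eqVneq l' j; first by rewrite col0 // mul0r.
  have [->|l'm] := eqVneq l' m; first by rewrite -mulrA col0 1?eq_sym // mulr0.
  (* [j], [l], [m], [l'] would be four column indices. *)
  exfalso; move: n3; rewrite leqNgt => /negP; apply.
  have: uniq [:: j; l; m; l'].
    by rewrite /= !inE !negb_or jl !(eq_sym _ l') l'j ll' l'm
      (eq_sym j) mj (eq_sym l) ml.
  by move/card_uniqP => /= <-; rewrite -[X in (_ <= X)%N]card_ord max_card.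
have pqp : p i j * p k l = p i j * p k l * p i j.
  rewrite -[LHS]mulr1 -(rowp i) mulr_sumr (bigD1 j) //= big1 ?addr0 //.
have <- : star (p i j * p k l) = p k l * p i j by rewrite star_mulr !sa.
by rewrite pqp !star_mulr !sa mulrA.
Qed.

End CStarAlgebraLemmas.

Arguments magic_unitary_entries_commute {R A n p}.
Arguments generated_by_commuting {R A n p}.

(** * Universal algebras *)

Lemma maps_generators_id (R : realType) (A : cstarAlgType R) (n : nat)
  (p : 'I_n -> 'I_n -> A) : maps_generators p p id.
Proof. by split. Qed.

Lemma maps_generators_comp (R : realType) (A B C : cstarAlgType R) (n : nat)
    (p : 'I_n -> 'I_n -> A) (q : 'I_n -> 'I_n -> B) (r : 'I_n -> 'I_n -> C)
    (f : A -> B) (g : B -> C) :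
  maps_generators p q f -> maps_generators q r g ->
  maps_generators p r (g \o f).
Proof.
move=> [[fL [f1 fM] fS] fp] [[gL [g1 gM] gS] gq]; split.
  split=> [c x y||x] /=; first by rewrite fL gL.
  - by split=> [|x y] /=; rewrite ?f1 ?g1 // fM gM.
  - by rewrite fS gS.
by move=> i j; rewrite /= fp gq.
Qed.

(** If the generators of [A] satisfy the relations defining [B], the universal
    property of [B] yields a map back to [A], inverse to [f] because both
    composites fix the generators. *)
Lemma universal_cstar_iso (R : realType) (n : nat)
    (rel rel' : forall B : cstarAlgType R, ('I_n -> 'I_n -> B) -> Prop)
    (A B : cstarAlgType R) (p : 'I_n -> 'I_n -> A) (q : 'I_n -> 'I_n -> B)
    (f : A -> B) :
  universal_cstar rel p -> universal_cstar rel' q -> rel' A p ->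
  maps_generators p q f -> star_iso f.
Proof.
move=> [relp _ uA] [relq _ uB] rel'p fpq; split; first by case: fpq.
have [g [gqp _]] := uB A p rel'p.
have [h [_ hA]] := uA A p relp.
have [h' [_ hB]] := uB B q relq.
exists g => x.
- have gf := maps_generators_comp _ _ _ _ _ _ _ _ _ _ fpq gqp.
  by rewrite -[LHS]/((g \o f) x) -(hA _ gf) (hA _ (maps_generators_id _ _ _ p)).
- have fg := maps_generators_comp _ _ _ _ _ _ _ _ _ _ gqp fpq.
  by rewrite -[LHS]/((f \o g) x) -(hB _ fg) (hB _ (maps_generators_id _ _ _ q)).
Qed.

Theorem proposition2p1 (R : realType) (n : nat)
    (hn : n = 1%N \/ n = 2%N \/ n = 3%N) :
  (forall (A : cstarAlgType R) (p : 'I_n -> 'I_n -> A),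
     is_A p -> forall x y : A, x * y = y * x) /\
  (forall (A Aab : cstarAlgType R) (p : 'I_n -> 'I_n -> A)
          (pab : 'I_n -> 'I_n -> Aab),
     is_A p -> is_Aab pab ->
     (exists! f : A -> Aab, maps_generators p pab f) /\
     (forall f : A -> Aab, maps_generators p pab f -> star_iso f)).
Proof.
have n3 : (n <= 3)%N by case: hn => [->|[->|->]].
split=> [A p [pU gen _]|A Aab p pab pA pabA].
  apply: (generated_by_commuting gen) => [i j|].
    by have [/(_ i j)[]] := pU.
  exact: magic_unitary_entries_commute.
have [pU _ uA] := pA; have [[pabU _] _ _] := pabA.
split; first exact: uA.
move=> f; apply: (universal_cstar_iso _ _ _ _ _ _ _ _ _ pA pabA).
by split=> //; exact: magic_unitary_entries_commute.
Qed.
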